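(* Let $\{x^k\}_{k\in\mathbb{N}}$ be generated by Algorithm RiVMPL (described in the context) and assume that $\{x^k\}_{k\in\mathbb{N}}$ is bounded. Let $\alpha^*=b_\alpha+\overline{\alpha}$ be as in the context, let $\varsigma^*:=\lim_{k\to\infty}\Theta(x^k)$, let $c_{\nabla F}:=\sup_{k\in\mathbb{N}}\|F'(x^k)\|$, and let $$\chi:=\frac{[\max\{\alpha^*,c_{\nabla F}\}]^{-1}}{(\alpha_{\min}^{-1}\mu_{\max})^{1/2}+1}.$$ Let $\epsilon>0$. Then: (i) if $\|v^{k,j}\|\le\chi\epsilon$ for some $k\in\mathbb{N}$ and $j\in\{0,1,\ldots,j_k\}$, then $x^k$ is an $\epsilon$-stationary point of the problem $\min_{x\in\mathcal{M}}\Theta(x)$; (ii) Algorithm RiVMPL, with its termination condition $\|v^{k,j}\|=0$ replaced by $\|v^{k,j}\|\le\chi\epsilon$, returns an $\epsilon$-stationary point within at most $K:=\Big\lceil\frac{2(\Theta(x^0)-\varsigma^* )}{\overline{\gamma}\chi^2\epsilon^2}\Big\rceil$ (outer) steps.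
   Context: Setting. $\mathbb{X},\mathbb{Z}$ are finite-dimensional real inner product spaces with induced norms $\|\cdot\|$; $\mathcal{M}\subset\mathbb{X}$ is a $\mathcal{C}^2$-smooth embedded closed submanifold with tangent spaces $T_x\mathcal{M}$ and normal spaces $N_x\mathcal{M}$. The problem is $\min_{x\in\mathcal{M}}\Theta(x):=f(x)+\vartheta(F(x))$ under the standing assumptions: (i) $f:\mathbb{X}\to(-\infty,\infty]$ is proper, lower semicontinuous, and $\mathcal{C}^{1,1}$ (differentiable with locally Lipschitz gradient) on an open convex set $\mathcal{O}\supset\mathcal{M}$; (ii) $\vartheta:\mathbb{Z}\to\mathbb{R}$ is convex with a closed-form proximal mapping; (iii) $F:\mathbb{X}\to\mathbb{Z}$ is $\mathcal{C}^{1,1}$ on $\mathcal{O}$ (differentiable with locally Lipschitz derivative); (iv) $\inf_{x\in\mathcal{M}}\Theta(x)>-\infty$. $F'(x)$ is the differential, $\nabla F(x)$ its adjoint, and $\ell_F(x;z):=F(z)+F'(z)(x-z)$. $\Pi_C$ is the projection onto $C$, $\mathcal{I}$ the identity, and $\|v\|_{\mathcal{Q}}^2:=\langle v,\mathcal{Q}v\rangle$. A retraction is a smooth map $R:T\mathcal{M}\to\mathcal{M}$ ($T\mathcal{M}$ the tangent bundle) such that $R_x:=R(x,\cdot):T_x\mathcal{M}\to\mathcal{M}$ satisfies $R_x(0)=x$ and $R_x'(0)=\mathcal{I}$ for every $x\in\mathcal{M}$. Algorithm RiVMPL. Input: a retraction $R$, parameters $0<\alpha_{\min}\le\alpha_{\max}$,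 $\mu_{\max}>0$, $\overline{\alpha}>0$, $\overline{\gamma}>0$, $\sigma>1$, and $x^0\in\mathcal{M}$. For $k=0,1,2,\ldots$: choose $\alpha_{k,0}\in[\alpha_{\min},\alpha_{\max}]$ and $\mu_k\in(0,\mu_{\max}]$. Inner loop, $j=0,1,2,\ldots$: choose a self-adjoint linear operator $\mathcal{Q}_{k,j}:\mathbb{X}\to\mathbb{X}$ with $\alpha_{k,j}\mathcal{I}\preceq\mathcal{Q}_{k,j}\preceq(\overline{\alpha}+\alpha_{k,j})\mathcal{I}$; let $$\Theta_{k,j}(v):=\langle\nabla f(x^k),v\rangle+\tfrac12\|v\|^2_{\mathcal{Q}_{k,j}}+\vartheta(\ell_F(x^k+v;x^k))+f(x^k)$$ and let $\overline{v}^{k,j}$ be its unique minimizer over $v\in T_{x^k}\mathcal{M}$; find $(v^{k,j},\Theta^{\rm LB}_{k,j})\in T_{x^k}\mathcal{M}\times(-\infty,\Theta_{k,j}(\overline{v}^{k,j})]$ with $\Theta_{k,j}(v^{k,j})\le\Theta_{k,j}(0)$ and $\Theta_{k,j}(v^{k,j})-\Theta^{\rm LB}_{k,j}\le\frac{\mu_k}{2}\|v^{k,j}\|^2$. If $\Theta(R_{x^k}(v^{k,j}))\le\Theta_{k,j}(v^{k,j})-\frac{\overline{\gamma}}{2}\|v^{k,j}\|^2$ or $\|v^{k,j}\|=0$, leave the inner loop; else set $\alpha_{k,j+1}:=\sigma\alpha_{k,j}$ and continue it. After the inner loop: if $\|v^{k,j}\|=0$, stop; else set $j_k:=j$, $v^k:=v^{k,j_k}$,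 $\overline{v}^k:=\overline{v}^{k,j_k}$, $\mathcal{Q}_k:=\mathcal{Q}_{k,j_k}$, $\Theta_k:=\Theta_{k,j_k}$, $x^{k+1}:=R_{x^k}(v^k)$. When $\{x^k\}$ is bounded there is a constant $b_\alpha>0$ with $\alpha_{k,j}\le b_\alpha$ for all $k\in\mathbb{N}$ and $j\in\{0,\ldots,j_k\}$; fix one and put $\alpha^*:=b_\alpha+\overline{\alpha}$, so that $\|\mathcal{Q}_{k,j}\|\le\alpha^*$. The sequence $\{\Theta(x^k)\}$ is convergent. A point $\overline{x}\in\mathcal{M}$ is an $\epsilon$-stationary point if there exist $\overline{z}\in\mathbb{Z}$ and $\overline{\xi}\in\partial\vartheta(\overline{z})$ such that $\max\{\|\Pi_{T_{\overline{x}}\mathcal{M}}(\nabla f(\overline{x})+\nabla F(\overline{x})\overline{\xi})\|,\|F(\overline{x})-\overline{z}\|\}\le\epsilon$. *)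

(* Defs.v *)
From HB Require Import structures.
From mathcomp Require Import all_boot all_order all_algebra.
From mathcomp Require Import all_classical all_reals all_analysis.
From mathcomp Require Import sesquilinear.

Set Implicit Arguments.
Unset Strict Implicit.
Unset Printing Implicit Defensive.

Import Order.TTheory GRing.Theory Num.Theory.
Import numFieldNormedType.Exports.

Local Open Scope classical_set_scope.
Local Open Scope ring_scope.

(* Finite-dimensional real inner product spaces; [normr_inner] says that the
   norm (hence the topology) is the one induced by the inner product. *)
HB.mixin Record NormedModule_isEuclidean (R : realType) V
    of NormedModule R V & Vector R V := {
  inner : {dot V for idfun} ;
  normr_inner : forall x : V, `|x| ^+ 2 = (inner : V -> V -> R) x x
}.

#[short(type="euclideanType")]
HB.structure Definition Euclidean (R : realType) :=
  {V of NormedModule R V & Vector R V & NormedModule_isEuclidean R V}.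

Definition dotp (R : realType) (X : euclideanType R) : X -> X -> R := inner.

Section Operators.
Variables (R : realType) (X Z : euclideanType R).

(* Riesz representative; it exists and is unique for every linear form. *)
Definition riesz (L : X -> R) : X := xget 0 [set g | forall v, dotp g v = L v].

Definition gradient (f : X -> R) (x : X) : X := riesz ('d f x).

Definition adjoint (L : X -> Z) (z : Z) : X := riesz (fun v => dotp z (L v)).

Definition opnorm (L : X -> Z) : R :=
  sup [set `|L v| | v in [set v | `|v| <= 1]].

(* Metric projection; single-valued when [C] is a linear subspace. *)
Definition proj (C : set X) (x : X) : X :=
  xget 0 [set y | C y /\ forall w, C w -> `|x - y| <= `|x - w|].

Definition subdiff (h : X -> R) (z : X) : set X :=
  [set xi | forall y, h z + dotp xi (y - z) <= h y].

Definition minimizer_over (C : set X) (h : X -> R) (v : X) : Prop :=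
  C v /\ forall w, C w -> h v <= h w.

End Operators.

(* C^n regularity on an open set. In finite dimension, [h] is C^(n+1) iff it
   is differentiable and all its directional derivatives are C^n. *)
Fixpoint Cdiff (R : realType) (V W : normedModType R) (n : nat)
    (U : set V) (h : V -> W) : Prop :=
  match n with
  | 0%N => forall x, U x -> {for x, continuous h}
  | n'.+1 => (forall x, U x -> differentiable h x) /\
             forall v, Cdiff n' U (fun x => 'd h x v)
  end.

Section Submanifolds.
Variables (R : realType) (X : euclideanType R).

(* [h] is a C^2 submersion from the open set [U] to R^m whose zero set is
   [M] in [U]. *)
Definition local_defining (M U : set X) (m : nat) (h : 'I_m -> X -> R) : Prop :=
  [/\ open U,
      forall i, Cdiff 2 U (h i),
      forall y, U y -> (M y <-> forall i, h i y = 0)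
    & forall y, U y -> forall w : 'I_m -> R,
        exists v, forall i, 'd (h i) y v = w i].

Definition C2_embedded_submanifold (M : set X) : Prop :=
  exists m : nat, forall x, M x ->
    exists (U : set X) (h : 'I_m -> X -> R), U x /\ local_defining M U h.

(* The kernel of h'(x) is the same for all local defining maps [h] at [x];
   it is written as the intersection of these equal kernels. *)
Definition tangent (M : set X) (x : X) : set X :=
  [set v | forall (m : nat) (U : set X) (h : 'I_m -> X -> R),
    U x -> local_defining M U h -> forall i, 'd (h i) x v = 0].

Definition tangent_bundle (M : set X) : set (X * X) :=
  [set p | M p.1 /\ tangent M p.1 p.2].

(* The tangent bundle of a C^2 manifold is a C^1 manifold, so smoothness of a
   map on it means C^1, i.e. having C^1 local extensions to the ambient space.
   The last clause is the Frechet differential of [v |-> Rt x v] at 0 on the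
   tangent space. *)
Definition retraction (M : set X) (Rt : X -> X -> X) : Prop :=
  [/\ forall x v, M x -> tangent M x v -> M (Rt x v),
      forall p, tangent_bundle M p ->
        exists (W : set (X * X)) (G : X * X -> X),
          [/\ open W, W p, Cdiff 1 W G &
              forall q, W q -> tangent_bundle M q -> G q = Rt q.1 q.2],
      forall x, M x -> Rt x 0 = x
    & forall x, M x -> forall e, 0 < e ->
        exists2 d : R, 0 < d & forall v, tangent M x v -> `|v| < d ->
          `|Rt x v - Rt x 0 - v| <= e * `|v|].

End Submanifolds.

Record problem (R : realType) (X Z : euclideanType R) := MkProblem {
  feas : set X ;            (* the manifold M *)
  fobj : X -> \bar R ;      (* f *)
  theta : Z -> R ;          (* vartheta *)
  Fmap : X -> Z             (* F *)
}.

Section Problem.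
Variables (R : realType) (X Z : euclideanType R) (P : problem X Z).

Let M := feas P.
Let f := fobj P.
Let F := Fmap P.

Definition Theta (x : X) : \bar R := (f x + (theta P (F x))%:E)%E.

Definition gradf (x : X) : X := gradient (fine \o f) x.

Definition ellF (x z : X) : Z := F z + 'd F z (x - z).

Definition f_assumption (O : set X) : Prop :=
  [/\ (forall x, f x != -oo%E) /\ (exists x, f x \is a fin_num),
      lower_semicontinuous f,
      forall x, O x -> f x \is a fin_num /\ differentiable (fine \o f) x
    & forall x, O x -> exists L : R, \forall y & z \near x,
        `|gradf y - gradf z| <= L * `|y - z|].

Definition F_assumption (O : set X) : Prop :=
  (forall x, O x -> differentiable F x) /\
  forall x, O x -> exists L : R, \forall y & z \near x,
    opnorm (fun v => 'd F y v - 'd F z v) <= L * `|y - z|.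

Definition standing_assumptions (O : set X) : Prop :=
  [/\ [/\ C2_embedded_submanifold M, closed M, open O, convex_set O & M `<=` O],
      f_assumption O,
      convex_function setT (theta P),
      F_assumption O
    & (-oo < ereal_inf [set Theta x | x in M])%E].

Definition eps_stationary (eps : R) (x : X) : Prop :=
  M x /\ exists z xi : Z, subdiff (theta P) z xi /\
    Num.max `|proj (tangent M x) (gradf x + adjoint ('d F x) xi)|
            `|F x - z| <= eps.

End Problem.

Record parameters (R : realType) (X : euclideanType R) := MkParameters {
  retr : X -> X -> X ;
  alpha_min : R ; alpha_max : R ; mu_max : R ;
  alpha_bar : R ; gamma_bar : R ; sigma : R
}.

Definition valid_parameters (R : realType) (X : euclideanType R)
    (M : set X) (p : parameters X) : Prop :=
  [/\ retraction M (retr p), 0 < alpha_min p <= alpha_max p, 0 < mu_max p &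
      [/\ 0 < alpha_bar p, 0 < gamma_bar p & 1 < sigma p]].

(* Everything that is chosen or computed along an execution. The entries with
   indices (k, j) are meaningful only for the inner iterations that are
   actually performed. *)
Record trace (R : realType) (X : euclideanType R) := MkTrace {
  xs : nat -> X ;
  mu : nat -> R ;
  alpha : nat -> nat -> R ;
  Q : nat -> nat -> {linear X -> X} ;
  vbar : nat -> nat -> X ;
  vs : nat -> nat -> X ;
  ThetaLB : nat -> nat -> R
}.

Section Algorithm.
Variables (R : realType) (X Z : euclideanType R) (P : problem X Z).
Variables (p : parameters X) (t : trace X).

Let M := feas P.

Definition Theta_model (k j : nat) (v : X) : R :=
  dotp (gradf P (xs t k)) v + 2^-1 * dotp v (Q t k j v)
  + theta P (ellF P (xs t k + v) (xs t k)) + fine (fobj P (xs t k)).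

Definition inner_step (k j : nat) : Prop :=
  let T := tangent M (xs t k) in
  let Qkj := Q t k j in
  [/\ forall u w, dotp (Qkj u) w = dotp u (Qkj w),
      forall u, alpha t k j * `|u| ^+ 2 <= dotp u (Qkj u)
                <= (alpha_bar p + alpha t k j) * `|u| ^+ 2,
      minimizer_over T (Theta_model k j) (vbar t k j),
      T (vs t k j) /\ ThetaLB t k j <= Theta_model k j (vbar t k j)
    & Theta_model k j (vs t k j) <= Theta_model k j 0 /\
      Theta_model k j (vs t k j) - ThetaLB t k j
        <= mu t k / 2 * `|vs t k j| ^+ 2].

Definition accepted (k j : nat) : Prop :=
  (Theta P (retr p (xs t k) (vs t k j))
   <= (Theta_model k j (vs t k j) - gamma_bar p / 2 * `|vs t k j| ^+ 2)%:E)%E.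

(* The algorithm is parametrized by its termination condition on v^{k,j}:
   [null_step] for the original algorithm, [short_step] for the variant. *)
Variable stop : X -> Prop.

(* At outer step [k] the inner loop is left precisely at [j = J]. *)
Definition inner_loop (k J : nat) : Prop :=
  [/\ alpha_min p <= alpha t k 0 <= alpha_max p,
      0 < mu t k <= mu_max p,
      forall j, (j <= J)%N -> inner_step k j,
      forall j, (j < J)%N -> ~ (accepted k j \/ stop (vs t k j)) /\
                             alpha t k j.+1 = sigma p * alpha t k j
    & accepted k J \/ stop (vs t k J)].

(* Outer step [k] is performed with j_k = [J], without termination. *)
Definition outer_step (k J : nat) : Prop :=
  [/\ inner_loop k J, ~ stop (vs t k J) & xs t k.+1 = retr p (xs t k) (vs t k J)].

Definition generates (jk : nat -> nat) : Prop :=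
  M (xs t 0) /\ forall k, outer_step k (jk k).

(* The algorithm terminates during outer step number [k] (counted from 0),
   after inner iteration [J], and returns [xs t k]. *)
Definition terminates_at (k J : nat) : Prop :=
  [/\ M (xs t 0),
      exists jk : nat -> nat, forall i, (i < k)%N -> outer_step i (jk i),
      inner_loop k J
    & stop (vs t k J)].

End Algorithm.

Definition null_step (R : realType) (X : euclideanType R) (v : X) : Prop :=
  `|v| = 0.

Definition short_step (R : realType) (X : euclideanType R) (r : R) (v : X) : Prop :=
  `|v| <= r.

Section Constants.
Variables (R : realType) (X Z : euclideanType R) (P : problem X Z).
Variables (p : parameters X) (t : trace X).

Definition Theta_limit : R := limn (fun k => fine (Theta P (xs t k))).

Definition c_gradF : R := sup (range (fun k => opnorm ('d (Fmap P) (xs t k)))).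

Definition chi (alpha_star : R) : R :=
  (Num.max alpha_star c_gradF)^-1
  / (Num.sqrt ((alpha_min p)^-1 * mu_max p) + 1).

Definition step_bound (alpha_star eps : R) : int :=
  Num.ceil (2 * (fine (Theta P (xs t 0)) - Theta_limit)
            / (gamma_bar p * chi alpha_star ^+ 2 * eps ^+ 2)).

End Constants.

(* Main.v *)
(* Strong convexity of the model turns the [mu/2 |v|^2] accuracy of the inexact
   minimizer [v] into [|vbar| <= (1 + sqrt (mu_max / alpha_min)) |v|] for the
   exact minimizer [vbar]. The first-order condition at [vbar], whose multiplier
   [xi] comes from the Hahn-Banach theorem, says that the projected gradient at
   [x^k] is the projection of [- Q vbar], while [z := F x^k + F'(x^k) vbar]
   differs from [F x^k] by [F'(x^k) vbar]; both are at most
   [max alpha_star c_gradF * |vbar|], which gives (i). For (ii), each outer step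
   decreases [Theta] by at least [gamma_bar / 2 |v^k|^2], so only finitely many
   steps are longer than [chi * eps]. *)

From HB Require Import structures.
Require Import Defs.
From mathcomp Require Import all_boot all_order all_algebra.
From mathcomp Require Import all_classical all_reals all_analysis.
From mathcomp Require Import sesquilinear ring lra.

Import Order.TTheory GRing.Theory Num.Theory.
Import numFieldNormedType.Exports.

Local Open Scope classical_set_scope.
Local Open Scope ring_scope.

(** * Inner products and Cauchy-Schwarz inequalities *)

Section InnerProduct.
Context {R : realType} {X : euclideanType R}.
Implicit Types (x y z : X) (a : R).

Lemma dotpC x y : dotp x y = dotp y x.
Proof. by rewrite /dotp hermC /= expr0 mul1r. Qed.

Lemma dotpDr x y z : dotp x (y + z) = dotp x y + dotp x z.
Proof. exact: linearDr. Qed.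

Lemma dotpZr a x y : dotp x (a *: y) = a * dotp x y.
Proof. exact: linearZr_LR. Qed.

Lemma dotpDl x y z : dotp (x + y) z = dotp x z + dotp y z.
Proof. by rewrite !(dotpC _ z) dotpDr. Qed.

Lemma dotpZl a x y : dotp (a *: x) y = a * dotp x y.
Proof. by rewrite !(dotpC _ y) dotpZr. Qed.

Lemma dotpxx x : dotp x x = `|x| ^+ 2.
Proof. by rewrite normr_inner. Qed.

Lemma dotp0 x : dotp x 0 = 0.
Proof. by rewrite -(scale0r 0) dotpZr mul0r. Qed.

Lemma dotpNr x y : dotp x (- y) = - dotp x y.
Proof. by rewrite -scaleN1r dotpZr mulN1r. Qed.

Lemma dotpNl x y : dotp (- x) y = - dotp x y.
Proof. by rewrite -scaleN1r dotpZl mulN1r. Qed.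

End InnerProduct.

(** Nonnegativity of the form on combinations of [u] and [w] is a discriminant condition. A general
    [Q] serves to bound [Q vbar] through its quadratic form alone; [idfun] gives the usual
    inequality. *)
Lemma psd_cauchy_schwarz {R : realType} {X : euclideanType R}
    (Q : {linear X -> X}) :
  (forall u w, dotp (Q u) w = dotp u (Q w)) -> (forall u, 0 <= dotp u (Q u)) ->
  forall u w, dotp u (Q w) ^+ 2 <= dotp u (Q u) * dotp w (Q w).
Proof.
move=> Qsym Qpos u w.
set a := dotp u (Q u); set b := dotp u (Q w); set c := dotp w (Q w).
have wu : dotp w (Q u) = b by rewrite -Qsym dotpC.
have quad s r : 0 <= s ^+ 2 * a + 2 * s * r * b + r ^+ 2 * c.
  have := Qpos (s *: u + r *: w).
  rewrite linearD !linearZ !dotpDl !dotpDr !dotpZl !dotpZr wu -/a -/b -/c.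
  by congr (_ <= _); ring.
have [c0|c0] := eqVneq c 0.
  (* With [c = 0] this choice gives [0 <= - b ^+ 2 * (a + 2)], which forces [b = 0]. *)
  have := quad b (- (a + 1)); have := Qpos u; have := sqr_ge0 b.
  rewrite c0 mulr0 -/a => *; nra.
have cpos : 0 < c by rewrite lt_neqAle eq_sym c0 Qpos.
have := quad c (- b).
suff -> : c ^+ 2 * a + 2 * c * - b * b + (- b) ^+ 2 * c = c * (a * c - b ^+ 2).
  by rewrite pmulr_rge0 // subr_ge0.
by ring.
Qed.

Lemma cauchy_schwarz {R : realType} {X : euclideanType R} (x y : X) :
  `|dotp x y| <= `|x| * `|y|.
Proof.
have dotp_ge0 (u : X) : 0 <= dotp u u by rewrite dotpxx sqr_ge0.
have := @psd_cauchy_schwarz R X idfun (fun _ _ => erefl) dotp_ge0 x y.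
rewrite /= !dotpxx -exprMn -ler_sqrt ?sqr_ge0// !sqrtr_sqr.
by rewrite (ger0_norm (mulr_ge0 _ _)).
Qed.

(** * Riesz representation and adjoints *)

Section Riesz.
Context {R : realType} {X : euclideanType R}.

(** The map sending [g] to its inner products with a basis is injective, hence onto the row vectors
    of the same dimension. *)
Lemma riesz_exists (L : {scalar X}) : exists g : X, forall v, dotp g v = L v.
Proof.
pose n := \dim {:X}; pose e := vbasis {:X}.
pose A (g : X) : 'rV[R]_n := \row_i dotp g e`_i.
have Alin : linear A.
  by move=> a x y; apply/rowP => i; rewrite !mxE dotpDl dotpZl.
pose Ah := GRing.isLinear.Build R X 'rV[R]_n *:%R A Alin.
pose A' : {linear X -> 'rV[R]_n} := HB.pack A Ah.
have expand v : v = \sum_(i < n) coord e i v *: e`_i.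
  by apply: coord_vbasis; rewrite memvf.
have AE g v : dotp g v = \sum_(i < n) coord e i v * A g 0 i.
  rewrite {1}[v]expand /dotp linear_sumr; apply: eq_bigr => i _.
  by rewrite mxE -dotpZr.
have ker0 : lker (linfun A') == 0%VS.
  apply/lker0P => x y; rewrite !lfunE /= => xy.
  apply/eqP; rewrite -subr_eq0 -normr_eq0 -sqrf_eq0 -dotpxx AE.
  apply/eqP; apply: big1 => i _.
  by rewrite mxE dotpDl dotpNl; move/rowP/(_ i): xy; rewrite !mxE => ->;
     rewrite subrr mulr0.
have img : limg (linfun A') = fullv.
  apply/eqP; rewrite eqEdim subvf limg_dim_eq; last by rewrite (eqP ker0) capv0.
  rewrite !dimvf dim_matrix mul1r /n dimvf; exact: leqnn.
have /memv_imgP[g _ gE] : \row_(i < n) L e`_i \in limg (linfun A').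
  by rewrite img memvf.
exists g => v; rewrite AE [in RHS](expand v) linear_sum; apply: eq_bigr => i _.
by rewrite linearZ /=; move: gE; rewrite lfunE /= => <-; rewrite mxE.
Qed.

Lemma rieszE (L : {scalar X}) v : dotp (riesz L) v = L v.
Proof.
rewrite /riesz; case: xgetP => [g _ /= -> //|noriesz].
by case: (riesz_exists L) => g /noriesz.
Qed.

End Riesz.

Lemma adjointE {R : realType} {X Z : euclideanType R} (L : {linear X -> Z})
  (z : Z) (v : X) : dotp (adjoint L z) v = dotp z (L v).
Proof.
have lin : linear_for *%R (fun v => dotp z (L v)).
  by move=> a x y; rewrite linearD linearZ dotpDr dotpZr.
pose h := GRing.isLinear.Build R X R *%R _ lin.
pose S : {scalar X} := HB.pack (fun v => dotp z (L v)) h.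
exact: (rieszE S).
Qed.

(** * Hahn-Banach extension under a convex majorant *)

Section HahnBanach.
Context {R : realType} {V : vectType R}.
Variable p : V -> R.
Hypothesis p_convex : forall s x y, 0 <= s <= 1 ->
  p (s *: x + (1 - s) *: y) <= s * p x + (1 - s) * p y.

(** Graph of a partial linear form. As a relation it can prescribe values on the image of a
    non-injective map; domination makes it single-valued in [hahn_banach]. *)
Definition linear_relation (G : V -> R -> Prop) :=
  G 0 0 /\ forall c u v r q, G u r -> G v q -> G (c *: u + v) (c * r + q).

Definition dominated (G : V -> R -> Prop) := forall u r, G u r -> r <= p u.

(* The value [a] separates the slopes of [p] along [- x] from those along [x];
   no independence of [x] from the domain of [G] is needed. *)
Lemma dominated_extension_value G x : linear_relation G -> dominated G ->
  exists a, forall u r s, G u r -> r + s * a <= p (u + s *: x).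
Proof.
move=> [G0 Glin] Gp.
pose A := [set a | exists u r s, [/\ 0 < s, G u r & a = (r - p (u - s *: x)) / s]].
have AB u r s : 0 < s -> G u r -> ubound A ((p (u + s *: x) - r) / s).
  move=> s0 Gur _ [w [q [t [t0 Gwq ->]]]].
  rewrite ler_pdivrMr// mulrAC ler_pdivlMr//.
  have st0 : 0 < s + t by rewrite addr_gt0.
  have stN0 : s + t != 0 by rewrite gt_eqF.
  (* Weight for which the multiples of [x] cancel in the convex combination, so that it lands in the
     domain of [G]. *)
  pose b := s / (s + t).
  have bC : 1 - b = t / (s + t) by rewrite /b; field.
  have b01 : 0 <= b <= 1.
    by rewrite /b divr_ge0 ?(ltW s0) ?(ltW st0)//= ler_pdivrMr// mul1r lerDl ltW.
  have := p_convex b (w - t *: x) (u + s *: x) b01.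
  have -> : b *: (w - t *: x) + (1 - b) *: (u + s *: x) = b *: w + (1 - b) *: u.
    rewrite !scalerDr scalerN !scalerA addrACA.
    suff -> : b * t = (1 - b) * s by rewrite addNr addr0.
    by rewrite bC /b; field.
  have Gmix : G (b *: w + (1 - b) *: u) (b * q + (1 - b) * r).
    by apply: (Glin) => //; move: (Glin (1 - b) _ _ _ _ Gur G0); rewrite !addr0.
  move=> /(le_trans (Gp _ _ Gmix)); rewrite bC /b.
  set P1 := p _; set P2 := p _.
  rewrite -subr_ge0 => le0; rewrite -subr_ge0.
  have := mulr_ge0 (ltW st0) le0.
  suff -> : (s + t) * (s / (s + t) * P1 + t / (s + t) * P2 -
    (s / (s + t) * q + t / (s + t) * r)) = (P2 - r) * t - (q - P1) * s by [].
  by field.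
have A0 : A !=set0 by exists ((0 - p (0 - 1 *: x)) / 1), 0, 0, 1; split.
have Aub : has_ubound A by exists ((p (0 + 1 *: x) - 0) / 1); exact: AB.
exists (sup A) => u r s Gur.
(* For [s > 0] the upper bounds [AB] apply, for [s < 0] the membership of a slope in [A]; [s = 0] is
   the domination of [G]. *)
have [s0|s0|->] := ltrgt0P s; last by rewrite mul0r scale0r !addr0 Gp.
- have := ge_sup A0 (AB u r s s0 Gur).
  by rewrite ler_pdivlMr// mulrC lerBrDl.
- have /(ub_le_sup Aub) : A ((r - p (u - (- s) *: x)) / (- s)).
    by exists u, r, (- s); split=> //; rewrite oppr_gt0.
  rewrite ler_pdivrMr ?oppr_gt0// scaleNr opprK mulrN mulrC.
  by rewrite lerBlDr -lerBlDl opprK addrC.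
Qed.

(** Adjoining the vectors of [xs] one at a time reaches the whole space when [xs] is a basis, so
    finite induction suffices. *)
Lemma dominated_extension G (xs : seq V) : linear_relation G -> dominated G ->
  exists G' : V -> R -> Prop, [/\ linear_relation G', dominated G',
    forall u r, G u r -> G' u r & forall x, x \in xs -> exists a, G' x a].
Proof.
move=> Glin Gp; elim: xs => [|x xs [G' [G'lin G'p GG' G'xs]]]; first by exists G.
have [a aP] := dominated_extension_value G' x G'lin G'p.
have [G'0 G'add] := G'lin.
pose G2 v q := exists u r s, [/\ G' u r, v = u + s *: x & q = r + s * a].
have GG2 u r : G' u r -> G2 u r.
  by move=> Gur; exists u, r, 0; rewrite scale0r mul0r !addr0.
exists G2; split.
- split; first exact: GG2.
  move=> c _ _ _ _ [u [r [s [Gur -> ->]]]] [w [q [t [Gwq -> ->]]]].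
  exists (c *: u + w), (c * r + q), (c * s + t); split; first exact: G'add.
    by rewrite scalerDr scalerDl scalerA addrACA.
  by ring.
- by move=> _ _ [u [r [s [Gur -> ->]]]]; exact: aP.
- by move=> u r /GG'/GG2.
- move=> y; rewrite inE => /orP[/eqP ->|/G'xs[b /GG2 G2b]]; last by exists b.
  by exists a, 0, 0, 1; rewrite scale1r mul1r !add0r.
Qed.

Lemma hahn_banach G : linear_relation G -> dominated G ->
  exists psi : {scalar V}, (forall v, psi v <= p v) /\
    forall u r, G u r -> psi u = r.
Proof.
move=> Glin Gp; pose e := vbasis {:V}.
have [G' [[G'0 G'add] G'p GG' G'e]] := dominated_extension G e Glin Gp.
have /choice[a aP] (i : 'I_(\dim {:V})) : exists b, G' e`_i b.
  by apply: G'e; rewrite mem_nth// size_tuple.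
pose psi v := \sum_(i < \dim {:V}) coord e i v * a i.
have psi_lin : linear_for *%R psi.
  move=> c x y; rewrite /psi mulr_sumr -big_split; apply: eq_bigr => i _ /=.
  by rewrite linearP mulrDl mulrA.
pose psiL : {scalar V} :=
  HB.pack psi (GRing.isLinear.Build R V R *%R psi psi_lin).
have G'psi v : G' v (psi v).
  rewrite [in X in G' X](coord_vbasis (memvf v)) /psi.
  elim: (index_enum _) => [|i s IH]; first by rewrite !big_nil.
  by rewrite !big_cons; exact: G'add.
exists psiL; split=> [v|u r /GG' G'ur]; first exact: G'p.
have G'0d c : G' 0 (c * (r - psi u)).
  have := G'add (- 1) _ _ _ _ (G'psi u) G'ur.
  rewrite scaleN1r addNr mulN1r addrC => /(G'add c)/(_ G'0).
  by rewrite scaler0 !addr0.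
apply/eqP; rewrite eq_sym -subr_eq0; apply/negPn/negP => d0.
(* This multiple would make [p 0 + 1] a value of [G'] at [0], contradicting domination. *)
have := G'p _ _ (G'0d ((p 0 + 1) / (r - psi u))).
by rewrite divfK// gerDl ler10.
Qed.

End HahnBanach.

(** * First-order tests, linear subspaces and metric projection *)

Lemma convex_functionTP {R : realType} {V : lmodType R} (h : V -> R) :
  convex_function (setT : set (convex_lmodType V)) h -> forall s x y,
  0 <= s <= 1 -> h (s *: x + (1 - s) *: y) <= s * h x + (1 - s) * h y.
Proof.
move=> h_convex s x y /andP[s0 s1].
by apply: (h_convex (@Itv01 R s s0 s1)); rewrite inE.
Qed.

(** For small [s] the linear term dominates, so a negative slope would show. This turns minimality
    along a segment into a first-order inequality. *)
Lemma affine_quadratic_slope_ge0 {R : realType} (c q : R) : 0 <= q ->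
  (forall s, 0 <= s <= 1 -> 0 <= s * c + s ^+ 2 * q) -> 0 <= c.
Proof.
move=> q0 hs; rewrite leNgt; apply/negP => c0.
have d0 : 0 < q - c by lra.
(* At this point of the unit interval the expression equals [c ^+ 3 / (q - c) ^+ 2], which is
   negative when [c] is. *)
have s01 : 0 <= - c / (q - c) <= 1.
  by rewrite divr_ge0 ?ler_pdivrMr//=; lra.
move: (hs _ s01); suff -> : - c / (q - c) * c + (- c / (q - c)) ^+ 2 * q =
   c ^+ 3 / (q - c) ^+ 2.
  by apply/negP; rewrite -ltNge pmulr_llt0 ?invr_gt0 ?exprn_gt0// exprn_odd_lt0.
by field; rewrite gt_eqF.
Qed.

Definition linear_subspace {R : realType} {X : lmodType R} (T : set X) :=
  T 0 /\ forall a u v, T u -> T v -> T (a *: u + v).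

Lemma tangent_linear_subspace {R : realType} {X : euclideanType R}
  (M : set X) x : linear_subspace (tangent M x).
Proof.
split=> [m U h Ux hU i|a u v Tu Tv m U h Ux hU i]; first by rewrite linear0.
by rewrite linearP (Tu m U h)// (Tv m U h)// addr0; exact: mulr0.
Qed.

(** Comparing [y] with [s *: w + y] for both signs of [s] makes the first-order term vanish. *)
Lemma metric_projection_orthogonal {R : realType} {X : euclideanType R}
    (T : set X) (u y : X) : linear_subspace T -> T y ->
    (forall w, T w -> `|u - y| <= `|u - w|) ->
  forall w, T w -> dotp (u - y) w = 0.
Proof.
move=> [_ Tlin] Ty ymin w Tw.
have quad s : 0 <= s * (- 2 * dotp (u - y) w) + s ^+ 2 * dotp w w.
  have := ymin _ (Tlin s _ _ Tw Ty).
  have -> : u - (s *: w + y) = u - y - s *: w by rewrite opprD addrCA addrC.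
  move: (u - y) => d; rewrite -ler_sqr ?nnegrE// -!dotpxx.
  rewrite dotpDl !dotpDr !dotpNl !dotpNr !dotpZl !dotpZr (dotpC w d).
  by lra.
have w0 : 0 <= dotp w w by rewrite dotpxx sqr_ge0.
have := affine_quadratic_slope_ge0 (- 2 * dotp (u - y) w) _ w0 (fun s _ => quad s).
suff : 0 <= 2 * dotp (u - y) w by move=> *; lra.
apply: (affine_quadratic_slope_ge0 _ _ w0) => s _.
by have := quad (- s); lra.
Qed.

(* If [u] has no metric projection on [T], then [proj T u] is the junk value
   [0], for which the bound is trivial. *)
Lemma norm_proj_le {R : realType} {X : euclideanType R} (T : set X)
    (u q : X) (C : R) : linear_subspace T -> 0 <= C ->
    (forall w, T w -> dotp (u + q) w = 0) ->
    (forall w, `|dotp q w| <= C * `|w|) ->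
  `|Defs.proj T u| <= C.
Proof.
move=> Tsub C0 uq qC; rewrite /Defs.proj.
case: xgetP => [y _ [Ty ymin]|_]; last by rewrite normr0.
(* Both orthogonality relations tested at [w = y] give [|y|^2 = - <q, y> <= C |y|]. *)
have := metric_projection_orthogonal _ _ _ Tsub Ty ymin y Ty.
have := uq y Ty; rewrite !dotpDl dotpNl dotpxx => uqy uyy.
have [->|y0] := eqVneq y 0; first by rewrite normr0.
rewrite -(@ler_pM2r _ `|y|) ?normr_gt0// (le_trans _ (qC y))//.
by have := ler_norm (- dotp q y); rewrite normrN; lra.
Qed.

(** * Optimality conditions for the convex composite model *)

Section CompositeModel.
Context {R : realType} {X Z : euclideanType R}.
Variables (T : set X) (g : X) (Q : {linear X -> X}) (L : {linear X -> Z}).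
Variables (theta : Z -> R) (z0 : Z) (vbar : X).

Let model v := dotp g v + 2^-1 * dotp v (Q v) + theta (z0 + L v).
Let zbar := z0 + L vbar.

Hypothesis T_subspace : linear_subspace T.
Hypothesis Q_sym : forall u w, dotp (Q u) w = dotp u (Q w).
Hypothesis Q_psd : forall u, 0 <= dotp u (Q u).
Hypothesis theta_convex : convex_function (setT : set (convex_lmodType Z)) theta.
Hypothesis vbar_min : minimizer_over T model vbar.

Lemma model_shift w : model (vbar + w) =
  model vbar + dotp (g + Q vbar) w + 2^-1 * dotp w (Q w)
  + (theta (zbar + L w) - theta zbar).
Proof.
rewrite /model !linearD addrA -/zbar !dotpDl !dotpDr (Q_sym vbar w).
rewrite -(Q_sym w vbar) (dotpC (Q w)); lra.
Qed.

(** Compare [vbar] with [vbar + s *: w]: by convexity the increment of [theta] is at most [s] times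
    the full one, and the quadratic term is of second order in [s]. *)
Lemma model_linearized_ge0 w : T w ->
  0 <= dotp (g + Q vbar) w + (theta (zbar + L w) - theta zbar).
Proof.
move=> Tw; apply: (@affine_quadratic_slope_ge0 _ _ (2^-1 * dotp w (Q w))).
  by rewrite mulr_ge0// invr_ge0.
move=> s s01; have [Tvbar vbar_le] := vbar_min.
have := vbar_le (vbar + s *: w); rewrite addrC.
move=> /(_ (T_subspace.2 _ _ _ Tw Tvbar)); rewrite addrC model_shift.
rewrite linearZ /= dotpZr linearZ /= dotpZl dotpZr.
have := convex_functionTP theta theta_convex s (zbar + L w) zbar s01.
have -> : s *: (zbar + L w) + (1 - s) *: zbar = zbar + s *: L w.
  by rewrite scalerDr scalerBl scale1r addrC addrA subrK.
set t1 := theta _; set t2 := theta (zbar + _); set t3 := theta zbar.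
by move=> *; lra.
Qed.

(** At [w = v - vbar] the linearized inequality absorbs everything in [model_shift] except the
    quadratic term. *)
Lemma model_quadratic_growth v : T v ->
  model vbar + 2^-1 * dotp (v - vbar) (Q (v - vbar)) <= model v.
Proof.
move=> Tv; have Tw : T (v - vbar).
  by rewrite addrC -scaleN1r; apply: T_subspace.2 => //; case: vbar_min.
have := model_linearized_ge0 _ Tw; have := model_shift (v - vbar).
rewrite [vbar + _]addrC subrK => ->; lra.
Qed.

(** Hahn-Banach extends [L w |-> - <g + Q vbar, w>] from the image of [T] to all of [Z], below the
    increments of [theta] at [zbar]; the Riesz representative of the extension is the
    subgradient. *)
Lemma model_multiplier : exists xi : Z, subdiff theta zbar xi /\
  forall w, T w -> dotp (g + Q vbar + adjoint L xi) w = 0.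
Proof.
pose p y := theta (zbar + y) - theta zbar.
have p_convex s x y : 0 <= s <= 1 ->
    p (s *: x + (1 - s) *: y) <= s * p x + (1 - s) * p y.
  move=> s01; rewrite /p.
  have := convex_functionTP theta theta_convex s (zbar + x) (zbar + y) s01.
  have -> : s *: (zbar + x) + (1 - s) *: (zbar + y) =
            zbar + (s *: x + (1 - s) *: y).
    by rewrite (scalerDr s zbar) (scalerDr _ zbar) addrACA -scalerDl subrKC scale1r.
  by move=> *; lra.
pose G y r := exists w, [/\ T w, y = L w & r = - dotp (g + Q vbar) w].
have Glin : linear_relation G.
  split; first by exists 0; rewrite linear0 dotp0 oppr0; split=> //; exact: T_subspace.1.
  move=> c _ _ _ _ [u [Tu -> ->]] [w [Tw -> ->]]; exists (c *: u + w).
  split; [exact: T_subspace.2 | by rewrite linearP | ].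
  by rewrite dotpDr dotpZr; ring.
have Gp : dominated p G.
  by move=> _ _ [w [Tw -> ->]]; rewrite -subr_ge0 opprK addrC model_linearized_ge0.
have [psi [psi_le psiG]] := hahn_banach p p_convex G Glin Gp.
have [xi xiE] := riesz_exists psi; exists xi; split.
  by move=> y /=; rewrite xiE -lerBrDl (le_trans (psi_le _))// /p subrKC.
move=> w Tw; rewrite dotpDl adjointE xiE (psiG _ (- dotp (g + Q vbar) w)) ?subrr//.
by exists w.
Qed.

End CompositeModel.

(** * Operator norms, compactness and bounded differentials *)

Section FiniteDimension.
Context {R : realType} {X Z : euclideanType R}.

(** Coordinates are inner products with fixed vectors, so Cauchy-Schwarz bounds them. *)
Lemma coord_norm_le (i : 'I_(\dim {:X})) :
  exists C : R, 0 <= C /\ forall v : X, `|coord (vbasis {:X}) i v| <= C * `|v|.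
Proof.
have [g gE] := riesz_exists (coord (vbasis {:X}) i).
by exists `|g|; split=> // v; rewrite -gE cauchy_schwarz.
Qed.

Lemma linear_norm_le (L : {linear X -> Z}) :
  exists2 C : R, 0 <= C & forall v, `|L v| <= C * `|v|.
Proof.
pose e := vbasis {:X}.
have [C CP] := choice coord_norm_le.
exists (\sum_i C i * `|L e`_i|).
  by apply: sumr_ge0 => i _; rewrite mulr_ge0//; case: (CP i).
move=> v; rewrite [in X in X <= _](coord_vbasis (memvf v)) linear_sum.
rewrite mulr_suml (le_trans (ler_norm_sum _ _ _))//; apply: ler_sum => i _.
rewrite linearZ normrZ mulrAC ler_wpM2r//; case: (CP i) => _; exact.
Qed.

(** Ensures that the [sup] in [opnorm] is a genuine least upper bound rather than a default
    value. *)
Lemma opnorm_has_sup (L : {linear X -> Z}) :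
  has_sup [set `|L v| | v in [set v : X | `|v| <= 1]].
Proof.
have [C C0 LC] := linear_norm_le L; split.
  by exists `|L 0|, 0; rewrite //= normr0.
by exists C => _ [v /= v1 <-]; rewrite (le_trans (LC v))// ler_piMr.
Qed.

Lemma opnorm_ge0 (L : {linear X -> Z}) : 0 <= opnorm L.
Proof.
apply: (@le_trans _ _ `|L 0|) => //.
by apply: ub_le_sup; [case: (opnorm_has_sup L)|exists 0; rewrite //= normr0].
Qed.

Lemma opnormP (L : {linear X -> Z}) v : `|L v| <= opnorm L * `|v|.
Proof.
have [->|v0] := eqVneq v 0; first by rewrite linear0 !normr0 mulr0.
have nv0 : 0 < `|v| by rewrite normr_gt0.
rewrite -ler_pdivrMr//; apply: ub_le_sup; first by case: (opnorm_has_sup L).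
exists (`|v|^-1 *: v) => /=.
  by rewrite normrZ ger0_norm ?invr_ge0// mulVf ?gt_eqF.
by rewrite linearZ normrZ ger0_norm ?invr_ge0// mulrC.
Qed.

Lemma opnorm_le (L : {linear X -> Z}) (C : R) :
  (forall v, `|v| <= 1 -> `|L v| <= C) -> opnorm L <= C.
Proof.
move=> LC; apply: ge_sup; first by case: (opnorm_has_sup L).
by move=> _ [v /LC ? <-].
Qed.

(** Heine-Borel for row vectors transfers along the continuous map [r]: the preimage of [A] is
    closed and bounded, and [A] is its image. *)
Lemma euclidean_bounded_closed_compact (A : set X) :
  bounded_set A -> closed A -> compact A.
Proof.
move=> [M0 [_ M0A]] Acl; pose M := M0 + 1.
have MA x : A x -> `|x| <= M by move=> Ax; apply: M0A => //; rewrite ltrDl.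
pose n := \dim {:X}; pose e := vbasis {:X}.
have [C CP] := choice coord_norm_le.
pose r (c : 'rV[R]_n) : X := \sum_(i < n) c 0 i *: e`_i.
have r_cont : continuous r.
  apply: continuous_big => [|i _ c]; first exact: add_continuous.
  apply: (@cvgZr_tmp _ _ _ _ (nbhs_filter c)).
  exact: (@coord_continuous R 1 n 0 i c).
have rA : r @` (r @^-1` A) = A.
  apply/seteqP; split=> [_ [c ? <-]//|x Ax].
  have rx : r (\row_i coord e i x) = x.
    rewrite [RHS](coord_vbasis (memvf x)); apply: eq_bigr => i _.
    by rewrite mxE.
  by exists (\row_i coord e i x) => //=; rewrite rx.
rewrite -rA; apply: continuous_compact.
  exact: continuous_subspaceT.
apply: bounded_closed_compact; last exact: closed_comp.
(* Each entry of [c] is a coordinate of [r c], hence bounded by one of the terms [C i * M]; their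
   sum bounds all entries at once. *)
exists (\sum_i C i * M); split=> [|y /ltW My c /= /MA rcM]; first exact: num_real.
apply: le_trans My.
have M0' : 0 <= M by exact: le_trans rcM.
have CM0 i : 0 <= C i * M by rewrite mulr_ge0//; case: (CP i).
rewrite /Num.norm /= mx_normrE; apply: bigmax_le => [|[i j] _ /=]; first exact: sumr_ge0.
have -> : c i j = coord e j (r c).
  by rewrite /r coord_sum_free ?(ord1 i)// (basis_free (vbasisP _)).
rewrite (bigD1 j)//= (le_trans ((CP j).2 _))//.
by rewrite -[leLHS]addr0 lerD ?sumr_ge0// ler_wpM2l//; case: (CP j).
Qed.

End FiniteDimension.

(** The Lipschitz condition bounds the norm near each point; compactness makes the bound uniform,
    through the covering principle applied to the filter at [+oo] of candidate constants. *)
Lemma differential_opnorm_bounded {R : realType} {X Z : euclideanType R}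
    (F : X -> Z) (K : set X) : compact K ->
    (forall x, K x -> exists L : R, \forall y & z \near x,
      opnorm (fun v => 'd F y v - 'd F z v) <= L * `|y - z|) ->
  exists C : R, forall x, K x -> opnorm ('d F x) <= C.
Proof.
move=> /compact_near_coveringP Kcov Flip.
have : \forall C \near +oo_R, K `<=` [set x | opnorm ('d F x) <= C].
  apply: (Kcov R _ (fun C x => opnorm ('d F x) <= C)) => x /Flip[L [[A B] /= [xA xB] AB]].
  (* Within distance 1 of [x] the norm exceeds that at [x] by at most [|L|]; the absolute value
     covers a negative [L]. *)
  exists (A `&` [set y | `|x - y| < 1], [set C | opnorm ('d F x) + `|L| <= C]).
    split=> /=; last by apply: nbhs_pinfty_ge; exact: num_real.
    by apply: filterI => //; apply/nbhs_normP; exists 1 => /=.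
  move=> [y C] /= [[Ay xy] /(le_trans _)]; apply.
  have Bx := nbhs_singleton xB. have := AB (y, x) (conj Ay Bx) => /= yxL.
  apply: opnorm_le => v v1.
  have -> : 'd F y v = 'd F x v + ('d F y \- 'd F x) v by rewrite /= subrKC.
  rewrite (le_trans (ler_normD _ _))// lerD//.
    by rewrite (le_trans (opnormP _ _))// ler_piMr// opnorm_ge0.
  rewrite (le_trans (opnormP _ _))//.
  rewrite (le_trans (ler_piMr (opnorm_ge0 _) v1))// (le_trans yxL)//.
  rewrite (le_trans (ler_norm _))// normrM normr_id ler_piMr//.
  by rewrite distrC ltW.
move=> /filter_ex[C CP]; by exists C.
Qed.

(** * Analysis of a single inner iteration *)

Section InnerIteration.
Context {R : realType} {X Z : euclideanType R} {P : problem X Z}.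
Context {p : parameters X} {t : trace X} {k j : nat}.

Let x := xs t k.
Let v := vs t k j.
Let vbar := vbar t k j.
Let T := tangent (feas P) x.
Let L := 'd (Fmap P) x.

Let model w := dotp (gradf P x) w + 2^-1 * dotp w (Q t k j w)
               + theta P (Fmap P x + L w).

Lemma Theta_modelE w :
  Theta_model P t k j w = model w + fine (fobj P x).
Proof. by rewrite /Theta_model /ellF (addrC (xs t k)) addrK. Qed.

Lemma Theta_model0 :
  Theta_model P t k j 0 = theta P (Fmap P x) + fine (fobj P x).
Proof.
by rewrite Theta_modelE /model linear0 dotp0 dotpC dotp0 mulr0 !add0r linear0 addr0.
Qed.

Hypothesis theta_convex : convex_function (setT : set (convex_lmodType Z)) (theta P).
Hypothesis step : inner_step P p t k j.
Hypothesis amin_gt0 : 0 < alpha_min p.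
Hypothesis amin_le : alpha_min p <= alpha t k j.
Hypothesis mu_bounds : 0 < mu t k <= mu_max p.

Lemma inner_step_psd u : 0 <= dotp u (Q t k j u).
Proof.
case: step => _ /(_ u)/andP[+ _] _ _ _; apply: le_trans.
by rewrite mulr_ge0// ?sqr_ge0// (le_trans _ amin_le) ?ltW.
Qed.

Lemma inner_step_minimizer : minimizer_over T model vbar.
Proof.
case: step => _ _ [Tvbar vbar_min] _ _; split=> // w /vbar_min.
by rewrite !Theta_modelE lerD2r.
Qed.

Let kappa := Num.sqrt ((alpha_min p)^-1 * mu_max p).

Lemma inner_step_norm_vbar : `|vbar| <= (kappa + 1) * `|v|.
Proof.
have [Q_sym Q_bounds _ [Tv LBle] [_ gap]] := step.
have Tsub := tangent_linear_subspace (feas P) x.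
have := model_quadratic_growth _ _ _ _ _ _ _ Tsub Q_sym inner_step_psd
  theta_convex inner_step_minimizer v Tv.
have /andP[Qlow _] := Q_bounds (v - vbar).
rewrite -/(model v) -/(model vbar) => growth.
(* Quadratic growth bounds [alpha_min / 2 * |v - vbar|^2] by the gap between the model values at [v]
   and [vbar], and [ThetaLB] certifies that this gap is at most [mu / 2 * |v|^2]. *)
have d2 : `|v - vbar| ^+ 2 <= (alpha_min p)^-1 * mu_max p * `|v| ^+ 2.
  rewrite -mulrA mulrC ler_pdivlMr// mulrC.
  have a_le : alpha_min p * `|v - vbar| ^+ 2 <= alpha t k j * `|v - vbar| ^+ 2.
    by rewrite ler_wpM2r ?sqr_ge0.
  have m_le : mu t k * `|v| ^+ 2 <= mu_max p * `|v| ^+ 2.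
    by rewrite ler_wpM2r ?sqr_ge0//; case/andP: mu_bounds.
  by move: gap LBle; rewrite !Theta_modelE -/v -/vbar; lra.
have d : `|v - vbar| <= kappa * `|v|.
  have c0 : 0 <= (alpha_min p)^-1 * mu_max p.
    have [/lt_le_trans mu0 mu_le] := andP mu_bounds.
    by rewrite mulr_ge0 ?invr_ge0 ?ltW// mu0.
  rewrite -[leLHS]ger0_norm// -[`|v| in leRHS]ger0_norm// -!sqrtr_sqr -sqrtrM//.
  by rewrite ler_sqrt// mulr_ge0// sqr_ge0.
by have := ler_normB v (v - vbar); rewrite subKr; lra.
Qed.

Lemma inner_step_eps_stationary (alpha_star c eps : R) : feas P x ->
    0 <= alpha_star -> alpha_bar p + alpha t k j <= alpha_star -> opnorm L <= c ->
    Num.max alpha_star c * ((kappa + 1) * `|v|) <= eps ->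
  eps_stationary P eps x.
Proof.
move=> Mx astar0 astar_le c_le eps_ge; split=> //.
have [Q_sym Q_bounds _ _ _] := step.
have Tsub := tangent_linear_subspace (feas P) x.
have [xi [xi_sub xi_orth]] := model_multiplier _ _ _ _ _ _ _ Tsub Q_sym
  inner_step_psd theta_convex inner_step_minimizer.
exists (Fmap P x + L vbar), xi; split=> //.
have bound a : 0 <= a -> a <= Num.max alpha_star c -> a * `|vbar| <= eps.
  move=> a0 a_le; apply: le_trans eps_ge; apply: ler_pM => //.
  exact: inner_step_norm_vbar.
have alpha_pos u : 0 <= dotp u (Q t k j u) <= alpha_star * `|u| ^+ 2.
  rewrite inner_step_psd /=; have /andP[_ /le_trans->//] := Q_bounds u.
  by rewrite ler_wpM2r ?sqr_ge0.
rewrite ge_max; apply/andP; split.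
  apply: (le_trans _ (bound alpha_star _ _)); rewrite ?le_max ?lexx//.
  apply: (norm_proj_le _ _ (Q t k j vbar)) => //.
  - by rewrite mulr_ge0.
  - by move=> w Tw; rewrite addrAC xi_orth.
  - move=> w; rewrite dotpC.
    (* Bounds on the quadratic form of [Q] at [w] and [vbar] give
       [|<w, Q vbar>| <= alpha_star |vbar| |w|]. *)
    have := psd_cauchy_schwarz _ Q_sym inner_step_psd w vbar.
    have /andP[w0 wle] := alpha_pos w; have /andP[b0 ble] := alpha_pos vbar.
    move=> /le_trans -/(_ _ (ler_pM w0 b0 wle ble)).
    have -> : alpha_star * `|w| ^+ 2 * (alpha_star * `|vbar| ^+ 2) =
              (alpha_star * `|vbar| * `|w|) ^+ 2 by ring.
    rewrite -ler_sqrt ?sqr_ge0// !sqrtr_sqr [leRHS]ger0_norm//.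
    by rewrite !mulr_ge0.
rewrite opprD addrA subrr sub0r normrN (le_trans (opnormP _ _))//.
by rewrite bound ?opnorm_ge0// le_max c_le orbT.
Qed.

End InnerIteration.

(** * Descent and finite termination along a run *)

Section Run.
Context {R : realType} {X Z : euclideanType R} {P : problem X Z} {O : set X}.
Context {p : parameters X} {t : trace X} {jk : nat -> nat}.
Hypothesis hP : standing_assumptions P O.
Hypothesis hp : valid_parameters (feas P) p.
Hypothesis hrun : generates P p t (@null_step R X) jk.

Lemma run_inner_loop k : inner_loop P p t (@null_step R X) k (jk k).
Proof. by case: hrun => _ /(_ k)[]. Qed.

Lemma run_inner_step k j : (j <= jk k)%N -> inner_step P p t k j.
Proof. by case: (run_inner_loop k) => _ _ + _ _; exact. Qed.

Lemma run_feasible k : feas P (xs t k).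
Proof.
elim: k => [|k IH]; first by case: hrun.
case: hrun => _ /(_ k)[_ _ ->]; case: hp => -[retrM _ _ _] _ _ _.
by apply: retrM => //; case: (run_inner_step k (jk k) (leqnn _)) => _ _ _ [].
Qed.

Lemma run_fobj_fin k : fobj P (xs t k) \is a fin_num.
Proof.
case: hP => -[_ _ _ _ MO] [_ _ + _] _ _ _ => /(_ (xs t k))[] //.
by apply: MO; exact: run_feasible.
Qed.

Lemma run_alpha_ge k j : (j <= jk k)%N -> alpha_min p <= alpha t k j.
Proof.
case: (run_inner_loop k) => /andP[a0 _] _ _ alphaS _.
have [_ /andP[amin0 _] _ [_ _ sigma1]] := hp.
elim: j => // j IH jlt; case: (alphaS j jlt) => _ ->.
apply: (le_trans (IH (ltnW jlt))); rewrite ler_peMl ?ltW//.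
by rewrite (lt_le_trans amin0)// IH// ltnW.
Qed.

(** The inner loop can only have been left by acceptance, since a null step would have ended the
    run. *)
Lemma run_accepted k : accepted P p t k (jk k).
Proof.
by case: hrun => _ /(_ k)[[_ _ _ _ [//|stop]] nstop _]; case: nstop.
Qed.

Let Th k := fine (Theta P (xs t k)).

Lemma run_Theta_fin k : Theta P (xs t k) = (Th k)%:E.
Proof. by rewrite /Th fineK// /Theta fin_numD run_fobj_fin. Qed.

(** The model at the accepted step is at most its value at [0], which is [Theta] at [xs t k]. *)
Lemma run_descent k :
  Th k.+1 + gamma_bar p / 2 * `|vs t k (jk k)| ^+ 2 <= Th k.
Proof.
have acc := run_accepted k; case: hrun => _ /(_ k)[_ _ xS].
have [_ _ _ _ [le0 _]] := run_inner_step k (jk k) (leqnn _).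
rewrite -lerBrDr; apply: (@le_trans _ _ (Theta_model P t k (jk k) (vs t k (jk k)) -
  gamma_bar p / 2 * `|vs t k (jk k)| ^+ 2)).
  by move: acc; rewrite /accepted -xS run_Theta_fin lee_fin.
rewrite lerD2r (le_trans le0)// Theta_model0.
by rewrite /Th /Theta fineD ?run_fobj_fin//= addrC.
Qed.

Lemma run_Theta_nonincreasing : {homo Th : n m / (n <= m)%N >-> m <= n}.
Proof.
apply/nonincreasing_seqP => k; apply: le_trans (run_descent k).
by rewrite lerDl mulr_ge0 ?sqr_ge0// divr_ge0//; case: hp => _ _ _ [_ /ltW].
Qed.

(** The [limn] in [Theta_limit] is a genuine limit: the values are nonincreasing and the infimum
    over [feas P] bounds them below. *)
Lemma run_Theta_limit_le k : Theta_limit P t <= Th k.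
Proof.
apply: (nonincreasing_cvgn_ge run_Theta_nonincreasing).
apply: (cvgP _ (nonincreasing_cvgn run_Theta_nonincreasing _)).
case: hP => _ _ _ _; set S := [set _ | _ in _] => inf_gt.
have inf_le n : (ereal_inf S <= (Th n)%:E)%E.
  by apply: ereal_inf_lbound; exists (xs t n);
    [exact: run_feasible | exact: run_Theta_fin].
exists (fine (ereal_inf S)) => _ [n _ <-].
rewrite -lee_fin fineK//; apply: fin_real.
by rewrite inf_gt (le_lt_trans (inf_le 0%N)) ?ltry.
Qed.

Lemma run_step_pos k : 0 < `|vs t k (jk k)|.
Proof.
by rewrite normr_gt0 -normr_eq0; apply/eqP; case: hrun => _ /(_ k)[].
Qed.

(* The strict decrease at step [N] makes the inequality strict. *)
Lemma run_long_steps_bound (r : R) N : 0 <= r ->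
    (forall k, (k < N)%N -> r <= `|vs t k (jk k)|) ->
  N%:R * (gamma_bar p / 2 * r ^+ 2) < Th 0%N - Theta_limit P t.
Proof.
move=> r0 long; have gamma0 : 0 < gamma_bar p / 2.
  by rewrite divr_gt0//; case: hp => _ _ _ [].
have sum : N%:R * (gamma_bar p / 2 * r ^+ 2) <= Th 0%N - Th N.
  elim: N long => [|N IH] long; first by rewrite mul0r subrr.
  have := IH (fun k kN => long k (ltnW kN)); have := run_descent N.
  have := long N (leqnn _); rewrite -ler_sqr ?nnegrE// => rN.
  have := ler_wpM2l (ltW gamma0) rN; rewrite -[N.+1%:R]natr1 mulrDl mul1r; lra.
have := run_descent N; have := run_Theta_limit_le N.+1.
have := mulr_gt0 gamma0 (exprn_gt0 2 (run_step_pos N)); lra.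
Qed.

(** By the Archimedean property, enough long steps would exceed the total decrease [gap]. *)
Lemma run_short_step_exists (r : R) : 0 < r ->
  exists k, `|vs t k (jk k)| <= r.
Proof.
move=> r0; pose D := gamma_bar p / 2 * r ^+ 2.
have D0 : 0 < D.
  by rewrite mulr_gt0 ?exprn_gt0// divr_gt0//; case: hp => _ _ _ [].
pose gap := Th 0%N - Theta_limit P t.
have gap0 : 0 <= gap by rewrite subr_ge0 run_Theta_limit_le.
have /archi_boundP := divr_ge0 gap0 (ltW D0); set N := Num.bound _.
rewrite ltr_pdivrMr// => gapN; apply: contrapT => noshort.
have := run_long_steps_bound r N (ltW r0); rewrite -/D -/gap => long.
suff /lt_trans/(_ gapN) : N%:R * D < gap by rewrite ltxx.
apply: long => k _; rewrite leNgt; apply/negP => kr.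
by apply: noshort; exists k; exact: ltW.
Qed.

(** A prefix of the run with the null stopping rule is a run of the variant: [k] is the first outer
    step containing a short inner iterate, and [J] the first such iterate in it. *)
Lemma run_first_short_step (r : R) : 0 < r -> exists k J,
  [/\ (J <= jk k)%N, terminates_at P p t (short_step r) k J &
    k%:R * (gamma_bar p / 2 * r ^+ 2) < Th 0%N - Theta_limit P t].
Proof.
(* Every inner iterate counts, not only the accepted one, since the variant tests each of them. *)
move=> r0; pose short k := [exists j : 'I_(jk k).+1, `|vs t k j| <= r].
have shortP k j : (j <= jk k)%N -> `|vs t k j| <= r -> short k.
  by move=> jle vr; apply/existsP; exists (Ordinal (jle : (j < (jk k).+1)%N)).
have ex_short : exists k, short k.
  by have [k kr] := run_short_step_exists r r0; exists k; exact: (shortP k (jk k)).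
case: (ex_minnP ex_short) => k /existsP[[j0 /= j0le] j0r] kmin.
case: (ex_minnP (ex_intro (fun j => `|vs t k j| <= r) j0 j0r)) => J Jr Jmin.
have Jle : (J <= jk k)%N by rewrite (leq_trans (Jmin _ j0r)).
have before i j : (i < k)%N -> (j <= jk i)%N -> ~ `|vs t i j| <= r.
  by move=> ik jle vr; have := kmin i (shortP i j jle vr); rewrite leqNgt ik.
exists k, J; split=> //; last first.
  apply: run_long_steps_bound => [|i ik]; first exact: ltW.
  by rewrite leNgt; apply/negP => /ltW; exact: before.
have [M0 steps] := hrun; split=> //.
(* Before step [k] no iterate is short, so both stopping rules produce the same inner loops. *)
- exists jk => i ik; have [[a mu step loop _] _ xS] := steps i.
  split=> //; last exact: before.
  split=> //; last by left; exact: run_accepted.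
  move=> j jlt; have [nstop aS] := loop j jlt; split=> //.
  by case=> [acc|]; [apply: nstop; left | apply: before => //; exact: ltnW].
(* At step [k] the loop is cut at [J], possibly before acceptance, and left because the iterate is
   short. *)
- have [a mu step loop _] := run_inner_loop k; split=> //.
  + by move=> j jJ; apply: step; exact: leq_trans Jle.
  + move=> j jJ; have [nstop aS] := loop j (leq_trans jJ Jle); split=> //.
    case=> [acc|vr]; first by apply: nstop; left.
    by have := Jmin j vr; rewrite leqNgt jJ.
  + by right.
Qed.

(** The iterates stay in a compact part of [feas P], where the differential is bounded, so the
    supremum defining [c_gradF] is finite. *)
Lemma c_gradF_ge k : bounded_set (range (xs t)) ->
  opnorm ('d (Fmap P) (xs t k)) <= c_gradF P t.
Proof.
move=> [B [_ xsB]].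
have [[_ Mclosed _ _ MO] _ _ [_ Flip] _] := hP.
(* The slack [1] appears because [bounded_set] bounds the norms by every number strictly above
   [B]. *)
pose K := feas P `&` [set x | `|x| <= B + 1].
have Kxs i : K (xs t i).
  by split; [exact: run_feasible | apply: xsB; [rewrite ltrDl | exists i]].
have Kcompact : compact K.
  apply: euclidean_bounded_closed_compact.
    exists (B + 1); split=> [|y yB x [_ /= xB]]; first exact: num_real.
    exact: le_trans (ltW yB).
  apply: closedI => //; apply: (closed_comp _ (@closed_le _ (B + 1))) => x _.
  exact: norm_continuous.
have [C CP] := differential_opnorm_bounded _ _ Kcompact
  (fun x Kx => Flip x (MO x Kx.1)).
apply: ub_le_sup; last by exists k.
by exists C => _ [i _ <-]; exact: CP.
Qed.

End Run.

Theorem theorem4p1 (R : realType) (X Z : euclideanType R)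
    (P : problem X Z) (O : set X) (p : parameters X)
    (t : trace X) (jk : nat -> nat) (b_alpha eps : R)
    (hP : standing_assumptions P O)
    (hp : valid_parameters (feas P) p)
    (hrun : generates P p t (@null_step R X) jk)
    (hbounded : bounded_set (range (xs t)))
    (hb0 : 0 < b_alpha)
    (hb : forall k j, (j <= jk k)%N -> alpha t k j <= b_alpha)
    (heps : 0 < eps) :
  let alpha_star := b_alpha + alpha_bar p in
  let chi := chi P p t alpha_star in
  (forall k j, (j <= jk k)%N -> `|vs t k j| <= chi * eps ->
     eps_stationary P eps (xs t k))
  /\
  (exists k J : nat,
     [/\ terminates_at P p t (short_step (chi * eps)) k J,
         (k.+1)%:Z <= step_bound P p t alpha_star eps
       & eps_stationary P eps (xs t k)]).
Proof.
move=> alpha_star chi.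
have [_ /andP[amin0 _] mu0 [abar0 gamma0 _]] := hp.
have astar0 : 0 < alpha_star by rewrite addr_gt0.
have max0 : 0 < Num.max alpha_star (c_gradF P t) by rewrite lt_max astar0.
have sqrt0 : 0 < Num.sqrt ((alpha_min p)^-1 * mu_max p) + 1.
  by rewrite ltr_wpDl ?sqrtr_ge0.
have chi0 : 0 < chi by rewrite divr_gt0 ?invr_gt0.
have part1 k j : (j <= jk k)%N -> `|vs t k j| <= chi * eps ->
    eps_stationary P eps (xs t k).
  move=> jle vle; have [_ mu_bounds _ _ _] := run_inner_loop hrun k.
  have [_ _ theta_convex _ _] := hP.
  apply: (inner_step_eps_stationary theta_convex
    (run_inner_step hrun k j jle) amin0 (run_alpha_ge hp hrun k j jle) mu_bounds
    alpha_star (c_gradF P t)).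
  - exact: run_feasible hp hrun k.
  - exact: ltW.
  - by rewrite addrC lerD2r hb.
  - exact: c_gradF_ge hP hp hrun k hbounded.
  (* [chi] is exactly the inverse of the factor multiplying the step norm. *)
  - rewrite mulrA -ler_pdivlMl ?mulr_gt0// (le_trans vle)//.
    by rewrite invfM /chi /Defs.chi.
split=> //.
have [k [J [Jle term kbound]]] :=
  run_first_short_step hP hp hrun (chi * eps) (mulr_gt0 chi0 heps).
exists k, J; split=> //; last by apply: (part1 k J) => //; case: term.
have den0 : 0 < gamma_bar p * chi ^+ 2 * eps ^+ 2.
  exact: mulr_gt0 (mulr_gt0 gamma0 (exprn_gt0 2 chi0)) (exprn_gt0 2 heps).
(* Steps are numbered from [0], so termination in step [k] takes [k + 1] steps; the strict bound on
   [k] puts [k + 1] at or below the ceiling. *)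
rewrite -addn1 PoszD lezD1 ceil_gt_int ltr_pdivlMr//.
by move: kbound; rewrite exprMn -pmulrn -/chi; lra.
Qed.
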